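(* Let $k\geq1$. A closed, pointed, convex cone $\mathcal{C}\subset\mathbb{R}^d$ is $k$-Terracini convex if and only if for any collection $x^{(1)},\ldots,x^{(k)}$ of generators of extreme rays of $\mathcal{C}$, $$\mathrm{span}\left(\bigcap_{i=1}^k\mathcal{N}_{\mathcal{C}}(x^{(i)})\right)=\bigcap_{i=1}^k\mathrm{span}\left(\mathcal{N}_{\mathcal{C}}(x^{(i)})\right).$$
   Context: A convex cone $\mathcal{C}$ is pointed if $\mathcal{C}\cap(-\mathcal{C})=\{0\}$. For $x\in\mathcal{C}$, let $\mathcal{K}_{\mathcal{C}}(x)=\mathrm{cone}\{z-x:z\in\mathcal{C}\}$ be the cone of feasible directions, $\overline{\mathcal{K}_{\mathcal{C}}(x)}$ the tangent cone, and $\mathcal{L}_{\mathcal{C}}(x)=\overline{\mathcal{K}_{\mathcal{C}}(x)}\cap-\overline{\mathcal{K}_{\mathcal{C}}(x)}$ the convex tangent space of $\mathcal{C}$ at $x$. The polar $\mathcal{C}^\circ$ is the set of linear functionals that are nonpositive on $\mathcal{C}$, and the normal cone at $x$ is $\mathcal{N}_{\mathcal{C}}(x)=\mathcal{K}_{\mathcal{C}}(x)^\circ=\{\ell\in\mathcal{C}^\circ:\ell(x)=0\}$. $\mathcal{C}$ is $k$-Terracini convex if $\mathcal{L}_{\mathcal{C}}\big(\sum_{i=1}^kx^{(i)}\big)=\sum_{i=1}^k\mathcal{L}_{\mathcal{C}}(x^{(i)})$ for any collection $x^{(1)},\ldots,x^{(k)}$ of generators of extreme rays of $\mathcal{C}$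 (collections may contain repetitions). *)

(* Defs.v *)
From HB Require Import structures.
From mathcomp Require Import all_boot all_order all_algebra.
From mathcomp Require Import all_classical all_reals all_analysis.

Set Implicit Arguments.
Unset Strict Implicit.
Unset Printing Implicit Defensive.

Import Order.TTheory GRing.Theory Num.Theory.
Import numFieldNormedType.Exports.

Local Open Scope classical_set_scope.
Local Open Scope ring_scope.

Section LinearSets.
Context {R : realType} {V : vectType R}.
Implicit Types (A : set V) (x v : V).

Definition opp_set A : set V := [set - v | v in A].

(* The Minkowski sum of the family A. *)
Definition sum_set (k : nat) (A : 'I_k -> set V) : set V :=
  [set \sum_(i < k) v i | v in [set v : 'I_k -> V | forall i, A i (v i)]].

Definition linear_span A : set V :=
  [set v | exists2 s : seq V, [set` s] `<=` A & v \in << s >>%VS].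

Definition conic_hull A : set V :=
  [set v | exists (n : nat) (a : 'I_n -> R) (w : 'I_n -> V),
     [/\ forall i, 0 <= a i, forall i, A (w i)
       & v = \sum_(i < n) a i *: w i]].

Definition ray x : set V := [set a *: x | a in [set a : R | 0 <= a]].

(* The empty set is not excluded here; it is excluded by [pointed] below. *)
Definition convex_cone A : Prop :=
  convex_set (A : set (convex_lmodType V)) /\
  (forall (a : R) v, 0 <= a -> A v -> A (a *: v)).

Definition pointed A : Prop := A `&` opp_set A = [set 0].

(* x generates an extreme ray when the ray through x is a one-dimensional face
   of A. *)
Definition extreme_generator A x : Prop :=
  [/\ x != 0, ray x `<=` A
    & forall y z, A y -> A z -> ray x (y + z) -> ray x y /\ ray x z].

Definition polar A : set 'Hom(V, R^o) :=
  [set l | forall v, A v -> (l v : R) <= 0].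

Definition feasible_cone A x : set V := conic_hull [set z - x | z in A].

Definition normal_cone A x : set 'Hom(V, R^o) := polar (feasible_cone A x).

Lemma normal_coneE A x : convex_cone A -> A x ->
  normal_cone A x = [set l | polar A l /\ (l x : R) = 0].
Proof.
move=> [_ coneA] Ax; apply/seteqP; split => l /=; last first.
  move=> [lA lx0] _ [n [a [w [a0 Aw ->]]]].
  rewrite linear_sum; apply: (@sumr_le0 R) => i _; rewrite linearZ.
  apply: (@mulr_ge0_le0 R) => //.
  by have [z Az <-] := Aw i; rewrite linearB /= lx0 subr0; exact: lA.
move=> Nl.
have lzx z : A z -> (l z : R) <= l x.
  move=> Az; rewrite -subr_le0 -linearB; apply: Nl.
  exists 1, (fun=> 1), (fun=> z - x); split => //; first by move=> _; exists z.
  by rewrite big_ord1 scale1r.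
have lx0 : (l x : R) = 0.
  apply/eqP; rewrite eq_le; apply/andP; split.
    have := lzx _ (coneA 2 x (ler0n _ _) Ax).
    by rewrite scaler_nat mulr2n linearD /= gerDl.
  by have := lzx _ (coneA 0 x (lexx _) Ax); rewrite scale0r linear0.
by split => // v /lzx; rewrite lx0.
Qed.

End LinearSets.

Section TangentSpace.
Context {R : realType} {d : nat}.
Implicit Types (C : set 'rV[R]_d) (x : 'rV[R]_d).

Definition tangent_cone C x : set 'rV[R]_d := closure (feasible_cone C x).

Definition convex_tangent_space C x : set 'rV[R]_d :=
  tangent_cone C x `&` opp_set (tangent_cone C x).

Definition terracini_convex (k : nat) C : Prop :=
  forall x : 'I_k -> 'rV[R]_d, (forall i, extreme_generator C (x i)) ->
  convex_tangent_space C (\sum_(i < k) x i) =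
  sum_set (fun i => convex_tangent_space C (x i)).

End TangentSpace.

(* Main.v *)
(* Separating a point from a closed convex cone by its nearest point in the cone
   gives the bipolar theorem, so L_C(x) is the common kernel N_C(x)^perp of the
   normal cone, and N_C(x_1 + ... + x_k) is the intersection of the N_C(x_i).
   Terracini convexity thus reads
     (bigcap_i N_C(x_i))^perp = sum_i N_C(x_i)^perp
                              = (bigcap_i span N_C(x_i))^perp,
   and both perps can be cancelled by finite-dimensional biduality. *)
Require Import Defs.
From HB Require Import structures.
From mathcomp Require Import all_boot all_order all_algebra.
From mathcomp Require Import all_classical all_reals all_analysis.
From mathcomp Require Import ring lra.

Import Order.TTheory GRing.Theory Num.Theory.
Import numFieldNormedType.Exports.

Local Open Scope classical_set_scope.
Local Open Scope ring_scope.

(** * Spans and annihilators of sets of functionals *)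

Section Annihilators.
Context {R : realType} {V : vectType R}.
Implicit Types (A : set 'Hom(V, R^o)) (B : set V) (s : seq 'Hom(V, R^o)).

Definition annihilator A : set V := [set v | forall l, A l -> l v = 0].

Definition coannihilator B : set 'Hom(V, R^o) :=
  [set l | forall v, B v -> l v = 0].

(** Take a finite family in [A] whose span has maximal dimension: adjoining another element of [A]
    cannot enlarge that span. *)
Lemma exists_spanning_seq {W : vectType R} (A : set W) :
  exists2 s : seq W, [set` s] `<=` A & A `<=` [set` << s >>%VS].
Proof.
pose P n := `[< exists2 s : seq W, [set` s] `<=` A & \dim << s >>%VS = n >].
have P0 : exists n, P n.
  by exists (\dim <<[::] : seq W>>%VS); apply/asboolP; exists [::].
have Pub n : P n -> (n <= \dim {:W})%N.
  by case/asboolP => s _ <-; rewrite dimvS// subvf.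
case: (ex_maxnP P0 Pub) => n /asboolP[s sA dims] nmax.
exists s => // a Aa /=; rewrite -[_ \in _]/(a \in << s >>%VS).
have : (<< s >> == << a :: s >>)%VS.
  rewrite eqEdim span_cons addvSr -span_cons dims nmax//; apply/asboolP.
  exists (a :: s) => // b; rewrite /= inE => /orP[/eqP->//|]; exact: sA.
by move=> /eqP->; rewrite memv_span// mem_head.
Qed.

Lemma linear_spanE {W : vectType R} (A : set W) :
  exists2 s : seq W, [set` s] `<=` A & linear_span A = [set` << s >>%VS].
Proof.
have [s sA As] := exists_spanning_seq A; exists s => //.
apply/seteqP; split => [v [r rA]|v vs]; last by exists s.
by apply/subvP/span_subvP => w /rA/As.
Qed.

Lemma subset_linear_span {W : vectType R} (A : set W) : A `<=` linear_span A.
Proof. by have [s sA As] := exists_spanning_seq A; move=> v /As vs; exists s. Qed.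

(** Finite form of biduality, relative to a subspace [U] so that the induction on [s] may shrink
    [U]; [annihilatorK] takes [U] to be the full space. *)
Lemma common_kernel_span s (U : {vspace V}) (l : 'Hom(V, R^o)) :
  (forall v, v \in U -> (forall m, m \in s -> m v = 0) -> l v = 0) ->
  exists2 m, m \in << s >>%VS & {in U, l =1 m}.
Proof.
(* Restricting to [lker a] removes [a] from the family. *)
elim: s U => [|a s IHs] U lU.
  exists 0 => [|v vU]; first by rewrite mem0v.
  by rewrite zero_lfunE; apply: lU.
have [v vU|m ms lm] := IHs (U :&: lker a)%VS.
  move: vU; rewrite memv_cap memv_ker => /andP[vU /eqP av0] sv0.
  by apply: lU => // m; rewrite inE => /orP[/eqP->//|]; exact: sv0.
have msa : m \in << a :: s >>%VS.
  by rewrite span_cons; apply: subvP (addvSr _ _) _ ms.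
have [a0|/existsNP[u /not_implyP[uU /eqP au0]]] :=
  pselect (forall v, v \in U -> a v = 0).
  by exists m => // v vU; apply: lm; rewrite memv_cap vU memv_ker a0//=.
(* This [c] makes [m + c *: a] agree with [l] at [u]. It also agrees with [l] on [U :&: lker a], and
   [U] is the sum of that subspace and the line through [u]. *)
pose c : R := (l u - m u) / a u.
exists (m + c *: a) => [|v vU].
  by rewrite memvD// memvZ// memv_span// mem_head.
have : l (v - (a v / a u : R) *: u) = m (v - (a v / a u : R) *: u).
  apply: lm; rewrite memv_cap memvB ?memvZ// memv_ker linearB linearZ /=.
  by rewrite /GRing.scale /= divfK// subrr.
rewrite !linearB !linearZ /= add_lfunE scale_lfunE /c /GRing.scale /= => e.
apply: (addIr (- (a v / a u * l u))); rewrite -mulrN e.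
by field.
Qed.

Lemma span_vanish s (v : V) l : (forall m, m \in s -> m v = 0) ->
  l \in << s >>%VS -> l v = 0.
Proof.
move=> sv0 ls; rewrite (@coord_span _ _ _ (in_tuple s) l ls) sum_lfunE.
by rewrite big1// => i _; rewrite scale_lfunE sv0 ?scaler0// mem_nth.
Qed.

Lemma annihilatorK A : coannihilator (annihilator A) = linear_span A.
Proof.
have [s sA spanE] := linear_spanE A.
apply/seteqP; split => [l lA|l [r rA lr] v vA] /=.
  have [v _ sv0|m ms lm] := common_kernel_span s fullv l.
    apply: lA => m /subset_linear_span; rewrite spanE; exact: span_vanish.
  suff -> : l = m by rewrite spanE.
  by apply/lfunP => v; apply: lm; rewrite memvf.
by apply: span_vanish lr => m /rA Am; exact: vA.
Qed.

End Annihilators.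

(** * Nearest points and separation from a closed convex cone *)

Section NearestPoint.
Context {R : realType} {d : nat}.
Implicit Types (K : set 'rV[R]_d) (u v w : 'rV[R]_d).

(** The norm on row vectors is the maximum norm, while the separation argument uses Euclidean
    distance. *)
Definition dot u v : R := \sum_j u 0 j * v 0 j.

Lemma dotDr u v w : dot u (v + w) = dot u v + dot u w.
Proof.
by rewrite -big_split; apply: eq_bigr => j _; rewrite mxE mulrDr.
Qed.

Lemma dotZr u a v : dot u (a *: v) = a * dot u v.
Proof. by rewrite mulr_sumr; apply: eq_bigr => j _; rewrite mxE mulrCA. Qed.

Lemma dotC u v : dot u v = dot v u.
Proof. by apply: eq_bigr => j _; rewrite mulrC. Qed.

Lemma dot_sqrD u (a : R) v :
  dot (u + a *: v) (u + a *: v) = dot u u + 2 * a * dot u v + a ^+ 2 * dot v v.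
Proof.
rewrite dotDr dotZr (dotC _ u) (dotC _ v) !dotDr !dotZr (dotC v u); ring.
Qed.

Lemma dotvv_ge0 v : 0 <= dot v v.
Proof. by apply: sumr_ge0 => j _; rewrite -expr2 sqr_ge0. Qed.

Lemma dotvv_eq0 v : dot v v = 0 -> v = 0.
Proof.
move=> /psumr_eq0P vv0; apply/rowP => j; rewrite mxE; apply/eqP.
by rewrite -sqrf_eq0 expr2 vv0// => i _; rewrite -expr2 sqr_ge0.
Qed.

Lemma dot_linear u : linear (dot u : 'rV[R]_d -> R^o).
Proof. by move=> a v w; rewrite dotDr dotZr. Qed.

HB.instance Definition _ u :=
  GRing.isLinear.Build R 'rV[R]_d R^o _ (dot u) (dot_linear u).

Lemma continuous_sqdist v :
  continuous (fun y : 'rV[R]_d => dot (v - y) (v - y)).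
Proof.
rewrite /dot; apply: continuous_big => [|j _].
  exact: add_continuous.
have c : continuous (fun y : 'rV[R]_d => (v - y) 0 j).
  have -> : (fun y : 'rV[R]_d => (v - y) 0 j) =
            (fun y : 'rV[R]_d => v 0 j - y 0 j).
    by apply/funext => y; rewrite !mxE.
  move=> y; apply: (@cvgB _ _ _ (nbhs y)); first exact: cvg_cst.
  exact: coord_continuous.
by move=> y; apply: (@cvgM _ _ (nbhs y)); exact: c.
Qed.

(** Cutting [K] by a sublevel set of the squared distance leaves a nonempty compact set, on which
    the minimum is attained. *)
Lemma nearest_point K v : closed K -> K !=set0 ->
  exists2 p, K p & forall y, K y ->
    dot (v - p) (v - p) <= dot (v - y) (v - y).
Proof.
move=> clK [z Kz]; pose f y := dot (v - y) (v - y).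
pose A := K `&` [set y | f y <= f z].
have clA : closed A.
  apply: closedI => //; apply: (@preimage_closed _ _ f [set x | x <= f z]).
    by move=> y _; exact: continuous_sqdist.
  exact: closed_le.
have bA : bounded_set A.
  (* Each coordinate satisfies [(v 0 j - y 0 j) ^+ 2 <= f z], and a real whose square is at most [s]
     has absolute value at most [s + 1]. *)
  exists (`|v| + f z + 1); split; first exact: num_real.
  move=> M ltM y [_ /= fyz]; apply/ltW/(le_lt_trans _ ltM).
  have fz0 : 0 <= f z by exact: dotvv_ge0.
  have normE (u : 'rV[R]_d) : `|u| = \big[Num.max/0]_ij `|u ij.1 ij.2|.
    exact: mx_normrE.
  rewrite (normE y); apply: bigmax_le => [|[i j] _] /=.
    by rewrite !addr_ge0.
  rewrite ord1.
  have vj : `|v 0 j| <= `|v|.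
    rewrite [leRHS]normE.
    exact: (le_bigmax _ (fun k : 'I_1 * 'I_d => `|v k.1 k.2|) (0, j)).
  have : (v 0 j - y 0 j) ^+ 2 <= f z.
    apply: le_trans fyz; rewrite /f /dot (bigD1 j)//= !mxE -expr2 lerDl.
    by apply: sumr_ge0 => k _; rewrite -expr2 sqr_ge0.
  move: vj; rewrite !ler_norml => /andP[? ?] ?; apply/andP; split; nra.
have [||p] := @compact_EVT_min _ R f A _ (bounded_closed_compact bA clA).
- by exists z; split => //=.
- by apply: continuous_subspaceT; exact: continuous_sqdist.
rewrite inE => -[Kp fpz] pmin; exists p => // y Ky.
have [fyz|/ltW fzy] := leP (f y) (f z); first by apply: pmin; rewrite inE.
exact: le_trans fpz fzy.
Qed.

(** Let [p] be the point of [K] nearest to [v] and [w = v - p]. Optimality gives [dot w <= 0] on [K]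
    and [0 <= dot w p], so [dot w v = dot w w + dot w p] is positive. *)
Lemma separation_closed_cone K v : closed K -> K 0 ->
  (forall y z, K y -> K z -> K (y + z)) ->
  (forall (a : R) y, 0 <= a -> K y -> K (a *: y)) ->
  ~ K v -> exists2 l : 'Hom('rV[R]_d, R^o), polar K l & 0 < (l v : R).
Proof.
move=> clK K0 KD KZ Kv.
have [|p Kp pmin] := nearest_point K v clK; first by exists 0.
set w := v - p.
(* First-order optimality of [p], used below with [y] in [K] and [y = - p]. *)
have opt y : (forall t : R, 0 <= t <= 1 -> K (p + t *: y)) -> dot w y <= 0.
  move=> Kpy; rewrite leNgt; apply/negP => wy0.
  have yy0 := dotvv_ge0 y.
  (* A step length in [[0, 1]] with [t * dot y y < dot w y]: the change
     [- 2 * t * dot w y + t ^+ 2 * dot y y] of the squared distance is then negative. *)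
  set t := dot w y / (dot w y + dot y y + 1).
  have tE : t * (dot w y + dot y y + 1) = dot w y by rewrite divfK//; lra.
  have t0 : 0 < t by rewrite divr_gt0//; lra.
  have t1 : 0 <= t <= 1 by apply/andP; split; nra.
  have := pmin _ (Kpy t t1).
  by rewrite opprD addrA -/w -scaleNr dot_sqrD; nra.
exists (linfun (dot w)) => [y Ky|]; rewrite lfunE /=.
  by apply: opt => t /andP[t0 _]; apply: KD => //; exact: KZ.
have vE : v = w + p by rewrite subrK.
(* Moving from [p] towards the apex stays in the cone, since [p - t *: p = (1 - t) *: p]. *)
have wp : dot w (- p) <= 0.
  apply: opt => t /andP[_ t1]; rewrite scalerN -[X in X - _]scale1r -scalerBl.
  by apply: KZ; rewrite ?subr_ge0.
have ww : dot w w != 0.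
  by apply/eqP => /dotvv_eq0/subr0_eq vp; apply: Kv; rewrite vp.
have := dotvv_ge0 w; rewrite le_eqVlt eq_sym (negPf ww)/= => ww0.
by rewrite vE dotDr; move: wp; rewrite -scaleN1r dotZr; lra.
Qed.

End NearestPoint.

(** * Biduality for subspaces and for sums of annihilators *)

Lemma annihilatorS {R : realType} {V : vectType R} (A B : set 'Hom(V, R^o)) :
  A `<=` B -> annihilator B `<=` annihilator A.
Proof. by move=> AB v vB l /AB; exact: vB. Qed.

Lemma annihilator_linear_span {R : realType} {V : vectType R}
  (A : set 'Hom(V, R^o)) : annihilator (linear_span A) = annihilator A.
Proof.
rewrite -annihilatorK; apply/seteqP; split => [|v vA l lA]; last exact: lA.
by rewrite annihilatorK; apply: annihilatorS; exact: subset_linear_span.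
Qed.

Lemma annihilator_vspace {R : realType} {V : vectType R}
    (A : set 'Hom(V, R^o)) :
  exists W : {vspace V}, annihilator A = [set` W].
Proof.
have [s sA spanE] := linear_spanE (annihilator A).
exists << s >>%VS; rewrite -spanE; apply/seteqP.
split=> [|v]; first exact: subset_linear_span.
rewrite spanE /= => vs l Al; apply/eqP; rewrite -memv_ker.
apply: subvP vs; apply/span_subvP => w ws.
by rewrite memv_ker; apply/eqP/sA.
Qed.

Lemma coannihilatorK {R : realType} {V : vectType R} (W : {vspace V}) :
  annihilator (coannihilator [set` W]) = [set` W].
Proof.
apply/seteqP; split => v /= vW; last by move=> l; exact.
apply: contrapT => /negP nvW.
set u := v - projv W v.
have u0 : u != 0.
  by apply: contra nvW; rewrite subr_eq0 => /eqP->; exact: memv_proj.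
(* Removing the [W]-component and then reading the coordinate along [u] gives a functional that
   vanishes on [W] and equals 1 at [v]. *)
pose l : 'Hom(V, R^o) :=
  (linfun (coord [tuple u] ord0 : V -> R^o) \o (\1 - projv W))%VF.
have lE y : l y = coord [tuple u] ord0 (y - projv W y).
  by rewrite comp_lfunE lfunE /= add_lfunE opp_lfunE id_lfunE.
have : l v = 0.
  by apply: vW => y yW; rewrite lE projv_id// subrr linear0.
rewrite lE -/u => /eqP; have := @coord_free _ _ _ [tuple u] ord0 ord0.
by rewrite seq1_free => /(_ u0) /= ->; rewrite oner_eq0.
Qed.

Lemma coannihilator_sum_set {R : realType} {V : vectType R} (k : nat)
    (B : 'I_k -> set V) : (forall i, B i 0) ->
  coannihilator (sum_set B) = \bigcap_(i in [set: 'I_k]) coannihilator (B i).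
Proof.
move=> B0; apply/seteqP; split => [l lB i _ v Bv|l lB _ [v Bv <-]] /=.
  (* A vector of one summand lies in the sum because the other sets contain 0. *)
  apply: lB; exists (fun j => if j == i then v else 0).
    by move=> j /=; case: eqP => [->|_].
  by rewrite -big_mkcond big_pred1_eq.
by rewrite linear_sum big1// => i _; exact: (lB i).
Qed.

(** Annihilators are subspaces, so their Minkowski sum is a subspace too and [coannihilatorK]
    applies to it. *)
Lemma sum_set_annihilatorK {R : realType} {V : vectType R} (k : nat)
    (A : 'I_k -> set 'Hom(V, R^o)) (S := sum_set (fun i => annihilator (A i))) :
  annihilator (coannihilator S) = S.
Proof.
have /choice[W WE] i := annihilator_vspace (A i).
suff -> : S = [set` (\sum_i W i)%VS] by exact: coannihilatorK.
apply/seteqP; split => [_ [v vA <-]|_ /memv_sumP[v vW ->]] /=.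
  by apply: memv_sumr => i _; have := vA i; rewrite WE.
by exists v => // i; rewrite WE; exact: vW.
Qed.

(** * Tangent spaces and normal cones *)

Section Terracini.
Context {R : realType} {d : nat}.
Implicit Types (C K : set 'rV[R]_d) (x v : 'rV[R]_d).

Lemma closureD K : (forall y z, K y -> K z -> K (y + z)) ->
  forall y z, closure K y -> closure K z -> closure K (y + z).
Proof.
move=> KD y z clKy clKz B /nbhs_ballP[e /= e0 yzB].
have e20 : 0 < e / 2 by rewrite divr_gt0.
have [y' [Ky']] := clKy _ (nbhsx_ballx y _ e20).
have [z' [Kz']] := clKz _ (nbhsx_ballx z _ e20).
rewrite -ball_normE /= => zz' yy'.
exists (y' + z'); split; first exact: KD.
apply: yzB; rewrite -ball_normE /= opprD addrACA.
by rewrite (le_lt_trans (ler_normD _ _))// [ltRHS]splitr ltrD.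
Qed.

Lemma closureZ K (a : R) : (forall y, K y -> K (a *: y)) ->
  forall y, closure K y -> closure K (a *: y).
Proof.
move=> KZ y clKy B aB.
have [y' [Ky' By']] := clKy _ (@scaler_continuous R 'rV[R]_d a y _ aB).
by exists (a *: y'); split => //; exact: KZ.
Qed.

Lemma conic_hull0 {V : vectType R} (A : set V) : conic_hull A 0.
Proof.
by exists 0, (fun=> 0), (fun=> 0); split => [[]//|[]//|]; rewrite big_ord0.
Qed.

Lemma conic_hullD {V : vectType R} (A : set V) y z :
  conic_hull A y -> conic_hull A z -> conic_hull A (y + z).
Proof.
move=> [n [a [u [a0 Au ->]]]] [m [b [w [b0 Aw ->]]]].
exists (n + m)%N,
  (fun i => match fintype.split i with inl j => a j | inr j => b j end),
  (fun i => match fintype.split i with inl j => u j | inr j => w j end); split.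
- by move=> i; case: fintype.split.
- by move=> i; case: fintype.split.
rewrite big_split_ord /=; congr (_ + _); apply: eq_bigr => i _.
  by rewrite (unsplitK (inl i)).
by rewrite (unsplitK (inr i)).
Qed.

Lemma conic_hullZ {V : vectType R} (A : set V) (c : R) y : 0 <= c ->
  conic_hull A y -> conic_hull A (c *: y).
Proof.
move=> c0 [n [a [u [a0 Au ->]]]]; exists n, (fun i => c * a i), u; split => //.
  by move=> i; rewrite mulr_ge0.
by rewrite scaler_sumr; apply: eq_bigr => i _; rewrite scalerA.
Qed.

Lemma continuous_functional (l : 'Hom('rV[R]_d, R^o)) :
  continuous (l : 'rV[R]_d -> R).
Proof.
have -> : (l : 'rV[R]_d -> R) =
    (fun v : 'rV[R]_d => \sum_j v 0 j * (l 'e_j : R)).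
  apply/funext => v; rewrite {1}(row_sum_delta v) linear_sum.
  by apply: eq_bigr => j _; rewrite linearZ.
apply: continuous_big => [|j _]; first exact: add_continuous.
move=> y; apply: (@cvgM _ _ (nbhs y)); first exact: coord_continuous.
exact: cvg_cst.
Qed.

Lemma polar_closure K l : polar K l -> polar (closure K) l.
Proof.
move=> lK; have clN : closed ((l : 'rV[R]_d -> R) @^-1` [set r | r <= 0]).
  apply: preimage_closed; last exact: closed_le.
  by move=> y _; exact: continuous_functional.
by move=> v Kv; apply: clN; apply: closureS Kv.
Qed.

(** The bipolar theorem: a functional separating [v] from the closed tangent cone is nonpositive on
    the feasible directions, hence normal, yet positive at [v]. *)
Lemma tangent_coneE C x : tangent_cone C x =
  [set v | forall l, normal_cone C x l -> (l v : R) <= 0].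
Proof.
apply/seteqP; split => [v Tv l /polar_closure|v Nv]; first exact.
apply: contrapT => nTv.
have [||||//|l lT] := separation_closed_cone (tangent_cone C x) v.
- exact: closed_closure.
- by apply: subset_closure; exact: conic_hull0.
- by apply: closureD => y z; exact: conic_hullD.
- by move=> a y a0; apply: closureZ => {}y; exact: conic_hullZ.
by rewrite ltNge Nv// => y Ky; apply: lT; exact: subset_closure.
Qed.

Lemma convex_tangent_spaceE C x :
  convex_tangent_space C x = annihilator (normal_cone C x).
Proof.
rewrite /convex_tangent_space tangent_coneE; apply/seteqP; split => v /=.
  move=> [vN [w wN wv]] l lN; apply/eqP; rewrite eq_le vN//=.
  by rewrite -wv linearN oppr_ge0 wN.
move=> vN; split=> [l lN|]; first by rewrite vN.
by exists (- v) => [l lN|]; [rewrite linearN /= vN ?oppr0|rewrite opprK].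
Qed.

Lemma convex_coneD C x v : convex_cone C -> C x -> C v -> C (x + v).
Proof.
move=> [convC coneC] Cx Cv.
have half01 : 0 <= (2^-1 : R) /\ (2^-1 : R) <= 1.
  by rewrite invr_ge0 ler0n invf_le1// ler1n.
have := convC x v (Itv01 half01.1 half01.2).
rewrite !inE => /(_ Cx Cv) /(coneC 2 _ (ler0n _ _)).
(* The sum is twice the midpoint, which convexity places in [C]. *)
set p := 2 *: _; suff -> : p = x + v by [].
rewrite {}/p /conv /= scalerDr !scalerA mulfV ?pnatr_eq0// scale1r.
rewrite /unstable.onem (_ : 2 * (1 - 2^-1) = 1) ?scale1r//.
by field.
Qed.

Lemma convex_cone_sum C k (x : 'I_k -> 'rV[R]_d) : C 0 -> convex_cone C ->
  (forall i, C (x i)) -> C (\sum_(i < k) x i).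
Proof.
by move=> C0 coneC Cx; apply: big_ind => // y z; exact: convex_coneD.
Qed.

(** For [l] in the polar, the values [l (x i)] are nonpositive, so their sum vanishes only if each
    does. Positivity of [k] excludes the empty intersection, which would contain every
    functional. *)
Lemma normal_cone_sum C k (x : 'I_k -> 'rV[R]_d) : (0 < k)%N ->
  convex_cone C -> (forall i, C (x i)) ->
  normal_cone C (\sum_(i < k) x i) =
  \bigcap_(i in [set: 'I_k]) normal_cone C (x i).
Proof.
move=> k0 coneC Cx; have C0 : C 0.
  by have := coneC.2 0 _ (lexx 0) (Cx (Ordinal k0)); rewrite scale0r.
rewrite normal_coneE//; last exact: convex_cone_sum.
under eq_bigcapr do rewrite normal_coneE//.
apply/seteqP; split => [l [lC lx0] i _|l lN] /=.
  split => //; apply/eqP; rewrite -oppr_eq0; apply/eqP.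
  apply: (@psumr_eq0P R _ predT (fun i => - (l (x i) : R))) => // [j _|].
    by rewrite oppr_ge0; exact: lC.
  by rewrite sumrN -linear_sum /= lx0 oppr0.
split; first by have [] := lN (Ordinal k0) I.
by rewrite linear_sum big1// => i _; have [] := lN i I.
Qed.

Lemma extreme_generator_mem C x : extreme_generator C x -> C x.
Proof. by case=> _ xC _; apply: xC; exists 1; [exact: ler01|rewrite scale1r]. Qed.

End Terracini.

Theorem proposition1p7 (R : realType) (d k : nat) (C : set 'rV[R]_d)
  (k_ge1 : (1 <= k)%N) (C_closed : closed C) (C_pointed : pointed C)
  (C_cone : convex_cone C) :
  terracini_convex k C <->
  (forall x : 'I_k -> 'rV[R]_d, (forall i, extreme_generator C (x i)) ->
     linear_span (\bigcap_(i in [set: 'I_k]) normal_cone C (x i)) =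
     \bigcap_(i in [set: 'I_k]) linear_span (normal_cone C (x i))).
Proof.
have tangentE (x : 'I_k -> 'rV[R]_d) : (forall i, extreme_generator C (x i)) ->
    convex_tangent_space C (\sum_(i < k) x i) =
    annihilator (\bigcap_(i in [set: 'I_k]) normal_cone C (x i)).
  move=> gx; rewrite convex_tangent_spaceE normal_cone_sum// => i.
  exact: extreme_generator_mem.
have spanE (x : 'I_k -> 'rV[R]_d) :
    \bigcap_(i in [set: 'I_k]) linear_span (normal_cone C (x i)) =
    coannihilator (sum_set (fun i => convex_tangent_space C (x i))).
  rewrite coannihilator_sum_set => [|i].
    by apply: eq_bigcapr => i _; rewrite convex_tangent_spaceE annihilatorK.
  by rewrite /= convex_tangent_spaceE => l _; rewrite linear0.
split=> H x gx; have := H x gx; rewrite spanE tangentE //.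
  (* Taking coannihilators in the Terracini identity gives the identity of spans. *)
  by move=> <-; rewrite annihilatorK.
(* Conversely, take annihilators in the identity of spans; biduality then recovers the sum of
   tangent spaces. *)
rewrite -annihilator_linear_span => ->.
have -> : (fun i => convex_tangent_space C (x i)) =
    (fun i => annihilator (normal_cone C (x i))).
  by apply/funext => i; exact: convex_tangent_spaceE.
exact: sum_set_annihilatorK.
Qed.
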